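(* (1) For every integer $d\ge 1$ there is a constant $r_d>0$ such that for every proper convex domain $D\subset\mathbb{R}^d$ and every $z\in D$, one has $s_D(z)\ge r_d$. (2) If $D\subset\mathbb{R}^d$ is a domain such that $\inf_{z\in D} s_D(z)>0$, then $D$ is convex and proper.
   Context: Let $\mathbb{P}\mathbb{R}^d=(\mathbb{R}^{d+1}\setminus\{0\})/\sim$, where $x\sim y$ iff $x=\lambda y$ for some $\lambda\in\mathbb{R}\setminus\{0\}$, and embed $\mathbb{R}^d$ in it as the points $(1:x_1:\dots:x_d)$. A projective map is a map of $\mathbb{P}\mathbb{R}^d$ induced by a linear map of $\mathbb{R}^{d+1}$; it is identified with its restriction to $\mathbb{R}^d$ (a linear-fractional map). For a domain $D\subset\mathbb{R}^d$ and $z\in D$, the (projective) squeezing function is $s_D(z)=\sup\{r>0:\ \exists$ a projective map $\Phi$ with $\Phi(z)=0$, $\Phi(D)\subset B(0,1)$ and $B(0,r)\subset\Phi(D)\}$, where $B(0,r)$ is the open Euclidean ball; one sets $s_D(z)=0$ if no such $\Phi$ exists. A convex domain is called proper if it contains no affine line. *)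

(* Defs.v *)
From mathcomp Require Import all_boot all_order all_algebra.
From mathcomp Require Import all_classical all_reals all_analysis.
Set Implicit Arguments. Unset Strict Implicit. Unset Printing Implicit Defensive.
Import Order.TTheory GRing.Theory Num.Theory.
Import numFieldNormedType.Exports.
Local Open Scope classical_set_scope.
Local Open Scope ring_scope.

Section Defs.
Variable R : realType.
Variable d : nat.
Implicit Types (D : set 'rV[R]_d) (x y z : 'rV[R]_d).

Definition sqnorm (x : 'rV[R]_d) : R := \sum_(i < d) x ord0 i ^+ 2.

Definition eball0 (r : R) : set 'rV[R]_d := [set y | sqnorm y < r ^+ 2].

Definition domain D := [/\ D !=set0, open D & connected D].

Definition proper_set D :=
  ~ exists p v : 'rV[R]_d, v != 0 /\ forall t : R, D (p + t *: v).

Definition homog x : 'rV[R]_(1 + d) := row_mx (const_mx 1) x.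

Definition pimg (M : 'M[R]_(1 + d)) x : 'rV[R]_(1 + d) := homog x *m M.
Definition pden (M : 'M[R]_(1 + d)) x : R := lsubmx (pimg M x) ord0 ord0.

(* the linear-fractional map induced by M (meaningful where pden M x != 0) *)
Definition pmap (M : 'M[R]_(1 + d)) x : 'rV[R]_d :=
  (pden M x)^-1 *: rsubmx (pimg M x).

(* r is admissible for (D,z): a projective map Phi, induced by an invertible
   linear map M of R^{d+1}, defined on all of D, with Phi z = 0,
   Phi(D) in B(0,1) and B(0,r) in Phi(D) *)
Definition squeeze_adm D z (r : R) :=
  0 < r /\ exists M : 'M[R]_(1 + d), [/\ M \in unitmx,
    (forall x, D x -> pden M x != 0),
    pmap M z = 0,
    (forall x, D x -> eball0 1 (pmap M x)) &
    (forall y, eball0 r y -> exists2 x, D x & pmap M x = y)].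

Definition squeezing D z : R :=
  if pselect (squeeze_adm D z !=set0) is left _ then sup (squeeze_adm D z) else 0.

End Defs.

(* Main.v *)
Require Import Defs.
From mathcomp Require Import all_boot all_order all_algebra perm.
From mathcomp Require Import all_classical all_reals all_analysis.
From mathcomp Require Import ring lra.
Import Order.TTheory GRing.Theory Num.Theory.
Import numFieldNormedType.Exports.
Local Open Scope classical_set_scope.
Local Open Scope ring_scope.

(** (1) Affine functionals g with g z = 1 and g >= 0 on D form a bounded convex
    body K, which spans the dual of R^(d+1) because D contains no line.  Choose
    d + 1 of them, f_0, ..., f_d, with |det| larger than half its supremum over
    K: by Cramer's rule every g in K is a combination of the f_i with
    coefficients in [-2, 2].  Take f_0 + ... + f_d as denominator.  Then D lies
    in the simplex f_i >= 0, with z at its barycenter, and a point X with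
    f_i X = 1 + e_i, sum |e_i| <= 1/4, satisfies g X >= 1/2 for every g in K,
    hence lies in D by separation.

    (2) Suppose that p, q are in D and w is the first parameter at which the
    segment from p to q leaves D.  For t < w, an admissible map Phi at the
    parameter t has a denominator of constant sign on D, so it restricts to the
    segment as (s - t) m / (affine of constant sign).  The bounds |Phi| < 1 at
    p and q and |Phi| >= r at w give r ((1 - w) t + w (1 - t)) < w - t, which
    fails as t tends to w with r bounded below. *)

(** * Nearest points and strict separation in Euclidean space *)

Section EuclideanSpace.
Set Implicit Arguments.
Unset Strict Implicit.
Context {R : realType} {d : nat}.
Implicit Types (D : set 'rV[R]_d) (x y z u v : 'rV[R]_d).

Lemma convex_setP D : convex_set D <->
  forall x y (t : R), D x -> D y -> 0 <= t -> t <= 1 ->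
    D (t *: x + (1 - t) *: y).
Proof.
split=> [cD x y t Dx Dy t0 t1|cD x y t].
  have := cD x y (Itv01 t0 t1).
  by rewrite !inE => /(_ Dx Dy).
by rewrite !inE => Dx Dy; apply: cD.
Qed.

Definition dot u v : R := \sum_i u ord0 i * v ord0 i.

Lemma sqnorm_ge0 u : 0 <= sqnorm u.
Proof. by apply: sumr_ge0 => i _; exact: sqr_ge0. Qed.

Lemma sqnorm_eq0 u : (sqnorm u == 0) = (u == 0).
Proof.
apply/eqP/eqP => [/psumr_eq0P u0|->].
  apply/rowP => i; rewrite mxE; apply/eqP; rewrite -sqrf_eq0; apply/eqP.
  by apply: u0 => // j _; exact: sqr_ge0.
by rewrite /sqnorm big1 // => i _; rewrite mxE expr0n.
Qed.

Lemma sqnormZ (k : R) u : sqnorm (k *: u) = k ^+ 2 * sqnorm u.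
Proof.
by rewrite /sqnorm mulr_sumr; apply: eq_bigr => i _; rewrite mxE exprMn.
Qed.

Lemma sqnormDZ u v (s : R) :
  sqnorm (u + s *: v) = sqnorm u + 2 * s * dot u v + s ^+ 2 * sqnorm v.
Proof.
rewrite /sqnorm /dot !mulr_sumr -!big_split /=; apply: eq_bigr => i _.
by rewrite !mxE; ring.
Qed.

Lemma dotDr u v w : dot u (v + w) = dot u v + dot u w.
Proof.
by rewrite /dot -big_split /=; apply: eq_bigr => i _; rewrite mxE mulrDr.
Qed.

Lemma dotuu u : dot u u = sqnorm u.
Proof. by apply: eq_bigr => i _; rewrite expr2. Qed.

Lemma coord_le_sqnorm u i : u ord0 i ^+ 2 <= sqnorm u.
Proof.
by rewrite /sqnorm (bigD1 i) //= lerDl sumr_ge0 // => j _; exact: sqr_ge0.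
Qed.

Lemma continuous_sqnormB x : continuous (fun u => sqnorm (u - x)).
Proof.
apply: (@continuous_big) => [|i _].
  exact: add_continuous.
move=> u.
have -> : (fun v => (v - x) ord0 i ^+ 2) =
    (@GRing.exp R ^~ 2%N) \o (fun v => v ord0 i - x ord0 i).
  by apply/funext => v /=; rewrite !mxE.
apply: continuous_comp; last exact: exprn_continuous.
apply: continuousB; first exact: coord_continuous.
exact: cst_continuous.
Qed.

Lemma open_cube D z : open D -> D z ->
  exists2 e : R, 0 < e & forall u, (forall i, `|u ord0 i| < e) -> D (z + u).
Proof.
move=> oD Dz.
have /nbhs_ballP[e e0 eD] : nbhs z D by apply: open_nbhs_nbhs.
exists e => // u ue; apply: eD; split=> // i j.
rewrite ord1 /ball /= mxE opprD addrA subrr add0r normrN; exact: ue.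
Qed.

(** Points outside a compact box around [x] are farther from [x] than [z] is, so the minimum over
    the box is global. *)
Lemma closest_point D x : D !=set0 ->
  exists2 y, closure D y &
    forall w, closure D w -> sqnorm (y - x) <= sqnorm (w - x).
Proof.
move=> [z Dz].
(* The box needs a half-width [C] with [C ^+ 2 >= sqnorm (z - x)]; adding 1 ensures this without a
   square root. *)
pose C := 1 + sqnorm (z - x).
have C1 : 1 <= C by rewrite lerDl sqnorm_ge0.
pose box := [set u : 'rV[R]_d | forall i,
  `[x ord0 i - C, x ord0 i + C]%classic (u ord0 i)].
have cbox : compact box.
  exact: (@rV_compact R d _ (fun i => @segment_compact R _ _)).
have cA : compact (box `&` closure D).
  by apply: compact_closedI => //; exact: closed_closure.
have boxP u : sqnorm (u - x) <= sqnorm (z - x) -> box u.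
  move=> uz i; rewrite /= in_itv /= -ler_distl.
  rewrite -ler_sqr ?nnegrE ?normr_ge0 ?(le_trans ler01) //.
  rewrite (real_normK (num_real _)).
  apply: le_trans (_ : sqnorm (z - x) <= _).
    by apply: le_trans uz; have := coord_le_sqnorm (u - x) i; rewrite !mxE.
  rewrite expr2; have := sqnorm_ge0 (z - x); rewrite /C; nra.
have A0 : box `&` closure D !=set0.
  by exists z; split; [exact: boxP|exact: subset_closure].
have [|y] := @EVT_min_rV R d (fun u => sqnorm (u - x)) _ A0 cA.
  by apply: continuous_subspaceT; exact: continuous_sqnormB.
rewrite inE => -[yb yD] ymin; exists y => // w wD.
have [wz|zw] := leP (sqnorm (w - x)) (sqnorm (z - x)).
  by apply: ymin; rewrite inE; split=> //; exact: boxP.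
apply: le_trans (ltW zw); apply: ymin; rewrite inE; split; first exact: boxP.
exact: subset_closure.
Qed.

(** The vector from [x] to the nearest point [y] of the closure works: moving from [y] towards a
    point of [D] cannot decrease the distance to [x]. *)
Lemma separation D x : convex_set D -> D !=set0 -> ~ closure D x ->
  exists v, forall w, D w -> 0 < dot v (w - x).
Proof.
move=> /convex_setP cD D0 xD.
have [y yD ymin] := closest_point x D0.
exists (y - x) => w Dw.
have yx0 : 0 < sqnorm (y - x).
  rewrite lt_def sqnorm_ge0 andbT sqnorm_eq0 subr_eq0.
  by apply: contra_notN xD => /eqP <-.
have conv s : 0 <= s -> s <= 1 -> closure D (s *: w + (1 - s) *: y).
  move=> s0 s1 B /= nB.
  have cf : {for y, continuous (fun u => s *: w + (1 - s) *: u)}.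
    apply: continuousD; first exact: cst_continuous.
    exact: scaler_continuous.
  have [u [Du Bu]] := yD _ (cf _ nB).
  by exists (s *: w + (1 - s) *: u); split => //; exact: cD.
have quad s : 0 <= s -> s <= 1 ->
    0 <= 2 * s * dot (y - x) (w - y) + s ^+ 2 * sqnorm (w - y).
  move=> s0 s1; have := ymin _ (conv s s0 s1).
  have -> : s *: w + (1 - s) *: y - x = (y - x) + s *: (w - y).
    by apply/rowP => i; rewrite !mxE; ring.
  by rewrite sqnormDZ -addrA lerDl.
suff : 0 <= dot (y - x) (w - y).
  have -> : w - x = (w - y) + (y - x) by rewrite addrA subrK.
  by rewrite (dotDr _ (w - y)) dotuu; lra.
rewrite leNgt; apply/negP => neg.
set a := dot _ _ in quad neg; set b := sqnorm (w - y) in quad.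
have b0 : 0 <= b by exact: sqnorm_ge0.
(* With this step [s * b <= - a], so the quadratic is at most [s * a < 0], against minimality. *)
pose s := - a / (b - a).
have ba : 0 < b - a by lra.
have s0 : 0 < s by rewrite divr_gt0 // oppr_gt0.
have s1 : s <= 1 by rewrite ler_pdivrMr //; lra.
have := quad s (ltW s0) s1.
have sb : s * b <= - a.
  by rewrite /s mulrAC ler_pdivrMr // ; nra.
nra.
Qed.

End EuclideanSpace.

(** * Cramer's rule and a crude bound on determinants *)

Section Determinant.
Set Implicit Arguments.
Unset Strict Implicit.

(** Cofactors along column [i] do not see that column, so they are those of [A], that is, entries of
    its adjugate. *)
Lemma cramer {F : fieldType} {n : nat} (A : 'M[F]_n) (g : 'cV[F]_n) (i : 'I_n) :
  A \in unitmx ->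
  \det (\matrix_(k, l) if l == i then g k ord0 else A k l) =
    \det A * (invmx A *m g) i ord0.
Proof.
move=> uA; rewrite (expand_det_col _ i) /invmx uA -scalemxAl mxE mulrA.
rewrite divff -?unitfE -?unitmxE // mul1r mxE; apply: eq_bigr => k _.
rewrite !mxE eqxx mulrC; congr (_ * \det _ * _).
by apply/matrixP => a b; rewrite !mxE eq_sym (negbTE (neq_lift _ _)).
Qed.

Lemma det_bound {R : realDomainType} {n : nat} (A : 'M[R]_n) (b : R) :
  (forall i j, `|A i j| <= b) -> `|\det A| <= n`!%:R * b ^+ n.
Proof.
move=> Ab; apply: le_trans (ler_norm_sum _ _ _) _.
apply: (@le_trans _ _ (\sum_(s : 'S_n) b ^+ n)).
  apply: ler_sum => s _; rewrite normrM normr_sign mul1r normr_prod.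

  rewrite -[n in b ^+ n]card_ord -prodr_const.
  by apply: ler_prod => i _; rewrite normr_ge0 Ab.
by rewrite sumr_const card_Sn mulr_natl.
Qed.

End Determinant.

(** * The body of normalized affine functionals nonnegative on the domain *)

Section Dual.
Set Implicit Arguments.
Unset Strict Implicit.
Context {R : realType} {d : nat}.
Implicit Types (D : set 'rV[R]_d) (x y z u v : 'rV[R]_d) (g : 'cV[R]_(1 + d)).

Definition ev g x : R := (homog x *m g) ord0 ord0.

(** The body K; a column holds the constant term of an affine functional, then its linear
    coefficients. *)
Definition dual_body D z : set 'cV[R]_(1 + d) :=
  [set g | ev g z = 1 /\ forall x, D x -> 0 <= ev g x].

Lemma homogDZ x u (t : R) :
  homog (x + t *: u) = homog x + t *: row_mx 0 u.
Proof. by rewrite /homog scale_row_mx add_row_mx scaler0 addr0. Qed.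

Lemma homog_conv x y (t : R) :
  homog (t *: x + (1 - t) *: y) = t *: homog x + (1 - t) *: homog y.
Proof.
rewrite /homog !scale_row_mx add_row_mx; congr row_mx.
by apply/rowP => i; rewrite !mxE; ring.
Qed.

Lemma ev_conv g x y (t : R) :
  ev g (t *: x + (1 - t) *: y) = t * ev g x + (1 - t) * ev g y.
Proof. by rewrite /ev homog_conv mulmxDl -!scalemxAl !mxE. Qed.

Lemma evE g x :
  ev g x = g (lshift d ord0) ord0 + \sum_i x ord0 i * g (rshift 1 i) ord0.
Proof.
rewrite /ev mxE big_split_ord /= big_ord1 row_mxEl mxE mul1r; congr (_ + _).
by apply: eq_bigr => i _; rewrite row_mxEr.
Qed.

Lemma ev_row_mx0 g u :
  (row_mx 0 u *m g) ord0 ord0 = \sum_i u ord0 i * g (rshift 1 i) ord0.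
Proof.
rewrite mxE big_split_ord /= big_ord1 row_mxEl mxE mul0r add0r.
by apply: eq_bigr => i _; rewrite row_mxEr.
Qed.

Lemma dual1 D z : dual_body D z (delta_mx (lshift d ord0) ord0).
Proof.
have ev1 x : ev (delta_mx (lshift d ord0) ord0) x = 1.
  rewrite evE mxE !eqxx big1 ?addr0 // => i _.
  by rewrite mxE eq_rlshift mulr0.
by split=> [|x _]; rewrite ev1.
Qed.

(* The supporting case t = 0 also holds, but t > 0 avoids a limit argument. *)
Lemma dual_separation D z x (t : R) : convex_set D -> open D -> D z -> ~ D x ->
  0 < t -> exists2 g, dual_body D z g & ev g x <= t.
Proof.
move=> cD oD Dz Dx t0.
have [e e0 eD] := open_cube oD Dz.
pose s := (1 + t)^-1.
have t1 : 1 + t != 0 by rewrite gt_eqF // addr_gt0.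
have s0 : 0 < s by rewrite invr_gt0 addr_gt0.
have s1 : s < 1 by rewrite invf_lt1 ?ltrDl // addr_gt0.
have sE : 1 - s = s * t by rewrite /s; field.
(* Moving x outwards takes it off the closure of D; it costs the error t. *)
pose x' := z + (1 + t) *: (x - z).
have xE : x = s *: x' + (1 - s) *: z.
  by apply/rowP => i; rewrite !mxE /s; field.
have nx' : ~ closure D x'.
  move=> /(_ (ball x' (t * e))) []; first exact/nbhsx_ballx/mulr_gt0.
  move=> y [Dy [_ yx']]; apply: Dx.
  have -> : x = s *: y + (1 - s) *: (z + t^-1 *: (x' - y)).
    rewrite xE sE; apply/rowP => i; rewrite !mxE /s; field.
    by rewrite t1 gt_eqF.
  move/convex_setP : cD; apply => //; [|exact: ltW|exact: ltW].
  apply: eD => i; have := yx' ord0 i; rewrite /ball /= => xyi.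
  rewrite mxE normrM gtr0_norm ?invr_gt0 // mulrC ltr_pdivrMr // (mulrC e).
  by rewrite mxE [(- y) _ _]mxE.
have [v vD] := separation cD (ex_intro _ z Dz) nx'.
pose c := dot v (z - x').
have c0 : 0 < c by exact: vD.
pose g : 'cV[R]_(1 + d) := c^-1 *: col_mx (const_mx (- dot v x')) v^T.
have gE w : ev g w = dot v (w - x') / c.
  rewrite evE /g !mxE (unsplitK (inl _)) mxE.
  transitivity (c^-1 * (- dot v x' + dot v w)).
    rewrite mulrDr; congr (_ + _); rewrite /dot mulr_sumr.
    by apply: eq_bigr => i _; rewrite !mxE (unsplitK (inr _)) !mxE; ring.
  rewrite mulrC /dot -sumrN -big_split /=; congr (_ * _).
  by apply: eq_bigr => i _; rewrite !mxE; ring.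
exists g.
  split=> [|w Dw]; rewrite gE; first by rewrite divff // gt_eqF.
  by rewrite ltW // divr_gt0 // vD.
rewrite xE ev_conv !gE subrr /dot.
rewrite [X in X / c](_ : _ = 0); last first.
  by rewrite big1 // => i _; rewrite !mxE mulr0.
rewrite -/(dot v (z - x')) divff ?gt_eqF // mul0r mulr0 add0r mulr1 sE.
by rewrite ger_pMl // ltW.
Qed.

(** Nonnegativity at the points [z] plus or minus [e / 2] along each axis bounds the linear
    coefficients by [2 / e]; the value 1 at [z] then bounds the constant term. *)
Lemma dual_bounded D z : open D -> D z ->
  exists b : R, forall g, dual_body D z g -> forall i, `|g i ord0| <= b.
Proof.
move=> oD Dz; have [e e0 eD] := open_cube oD Dz.
pose c := 2 / e; have c0 : 0 < c by rewrite divr_gt0.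
have sum0 : 0 <= \sum_i `|z ord0 i| * c.
  by apply: sumr_ge0 => i _; rewrite mulr_ge0 // ltW.
exists (c + 1 + \sum_i `|z ord0 i| * c) => g [gz gD].
have evd k j : ev g (z + k *: delta_mx ord0 j) = 1 + k * g (rshift 1 j) ord0.
  rewrite /ev homogDZ mulmxDl -scalemxAl mxE -/(ev g z) gz mxE ev_row_mx0.
  rewrite (bigD1 j) //= big1 ?addr0 => [|i ij]; first by rewrite mxE !eqxx mul1r.
  by rewrite mxE (negbTE ij) andbF mul0r.
have gi j : `|g (rshift 1 j) ord0| <= c.
  have dpos k : `|k| < e -> 0 <= 1 + k * g (rshift 1 j) ord0.
    move=> ke; rewrite -evd; apply/gD/eD => i; rewrite !mxE /=.
    case: eqP => _ /=; first by rewrite mulr1.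
    by rewrite mulr0 normr0.
  have e2 : `|e / 2| < e by rewrite gtr0_norm ?divr_gt0 //; lra.
  have := dpos _ e2; have := dpos (- (e / 2)); rewrite normrN => /(_ e2).
  rewrite /c ler_norml -[- (2 / e)]mulNr ler_pdivlMr // ler_pdivrMr //.
  by move=> h1 h2; apply/andP; split; lra.
move=> i; have [j ->|j ->] := split_ordP i; last first.
  by apply: le_trans (gi j) _; lra.
have -> : j = ord0 by apply/val_inj; case: j => -[].
move: gz; rewrite evE => /eqP; rewrite eq_sym -subr_eq => /eqP <-.
apply: le_trans (ler_normB _ _) _; rewrite normr1.
suff : `|\sum_i z ord0 i * g (rshift 1 i) ord0| <= \sum_i `|z ord0 i| * c by lra.
apply: le_trans (ler_norm_sum _ _ _) _; apply: ler_sum => k _.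
by rewrite normrM ler_wpM2l.
Qed.

(** If every functional of K kills [w], the constant 1 shows that [w] is a pure direction. All of K
    then equals 1 along the line through [z] in that direction, and separation puts the line in
    [D]. *)
Lemma dual_nondegenerate D z (w : 'rV[R]_(1 + d)) : convex_set D -> open D ->
  proper_set D -> D z -> w != 0 ->
  exists2 g, dual_body D z g & (w *m g) ord0 ord0 != 0.
Proof.
move=> cD oD pD Dz w0; apply: contrapT => h.
have hw g : dual_body D z g -> (w *m g) ord0 ord0 = 0.
  by move=> Dg; apply/eqP; apply: contrapT => /negP wg; apply: h; exists g.
have w1 : w ord0 (lshift d ord0) = 0.
  have := hw _ (dual1 D z); rewrite mxE (bigD1 (lshift d ord0)) //= mxE !eqxx.
  rewrite mulr1 big1 ?addr0 // => i i0.
  by rewrite mxE (negbTE i0) mulr0.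
have wE : w = row_mx 0 (rsubmx w).
  rewrite -[LHS]hsubmxK; congr row_mx; apply/rowP => i.
  by rewrite !mxE -w1; congr (w _ (lshift _ _)); apply/val_inj; case: i => -[].
apply: pD; exists z, (rsubmx w); split.
  by apply: contra_neq w0 => w'0; rewrite wE w'0 row_mx0.
move=> t; apply: contrapT => zt.
have [//|g gD] := dual_separation cD oD Dz zt (t := 2^-1).
have [gz _] := gD.
rewrite /ev homogDZ -wE mulmxDl -scalemxAl mxE -/(ev g z) gz mxE hw //.
by rewrite mulr0 addr0; lra.
Qed.

(** Columns are added one by one: with fewer than [1 + d] of them, some nonzero row [w] kills them
    all, and a functional not killed by [w] is independent of them. *)
Lemma dual_basis D z : convex_set D -> open D -> proper_set D -> D z ->
  exists2 F : 'M[R]_(1 + d), (forall j, dual_body D z (col j F)) & F \in unitmx.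
Proof.
move=> cD oD pD Dz.
suff H k : (k <= 1 + d)%N -> exists2 F : 'M[R]_(1 + d, k),
    (forall j, dual_body D z (col j F)) & forall u : 'cV_k, F *m u = 0 :> 'cV_(1 + d) -> u = 0.
  have [F FD Finj] := H _ (leqnn _); exists F => //.
  rewrite -unitmx_tr -row_free_unit -kermx_eq0; apply/eqP/row_matrixP => i.
  rewrite row0; apply: trmx_inj; rewrite trmx0; apply: Finj.
  by apply: trmx_inj; rewrite trmx_mul trmxK trmx0 -row_mul mulmx_ker row0.
elim: k => [_|k IH kd].
  by exists 0 => [[]|u _] //; apply/colP => -[].
have [F FD Finj] := IH (ltnW kd).
have /rowV0Pn[w /sub_kermxP wF w0] : kermx F != 0.
  rewrite kermx_eq0 /row_free neq_ltn (leq_ltn_trans (rank_leq_col F)) //.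
have [g gD wg] := dual_nondegenerate cD oD pD Dz w0.
suff : exists2 G : 'M[R]_(1 + d, 1 + k), (forall j, dual_body D z (col j G)) &
  forall u : 'cV_(1 + k), G *m u = 0 -> u = 0 by [].
exists (row_mx g F).
  move=> j; have [i ->|i ->] := split_ordP j.
    by rewrite colKl (_ : col i g = g) //; apply/colP => a; rewrite mxE ord1.
  by rewrite colKr.
move=> u; rewrite -[u]vsubmxK mul_row_col => Fu.
have u1 : usubmx (m1 := 1) u = 0.
  move/(congr1 (mulmx w)) : Fu; rewrite mulmx0 mulmxDr !mulmxA wF mul0mx addr0.
  move/matrixP => /(_ ord0 ord0); rewrite mxE big_ord1 [RHS]mxE => /eqP.
  rewrite mulf_eq0 (negbTE wg) /= => /eqP u0.
  by apply/colP => i; rewrite [RHS]mxE ord1.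
move: Fu; rewrite u1 mulmx0 add0r => /Finj ->.
by rewrite col_mx0.
Qed.

(** Replacing a column of [F] by [g] keeps all columns in K, so the new determinant is at most the
    supremum, hence at most [2 * |det F|]. Settling for half the supremum avoids proving that it is
    attained. *)
Lemma dual_almost_maximal_basis D z : convex_set D -> open D -> proper_set D -> D z ->
  exists F : 'M[R]_(1 + d), [/\ forall j, dual_body D z (col j F), F \in unitmx &
    forall g, dual_body D z g -> forall i, `|(invmx F *m g) i ord0| <= 2].
Proof.
move=> cD oD pD Dz.
pose E := [set `|\det F| | F in
  [set F : 'M[R]_(1 + d) | forall j, dual_body D z (col j F)]].
have [b Db] := dual_bounded oD Dz.
have Eub : has_ubound E.
  exists ((1 + d)`!%:R * b ^+ (1 + d)) => _ [F FD <-]; apply: det_bound => i j.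
  by have := Db _ (FD j) i; rewrite mxE.
have [F0 F0D uF0] := dual_basis cD oD pD Dz.
have EF0 : E `|\det F0| by exists F0.
have supE : 0 < sup E.
  apply: lt_le_trans (ub_le_sup Eub EF0).
  by rewrite normr_gt0 -unitfE -unitmxE.
have [||_ [F FD <-] Fsup] := @sup_gt _ E (sup E / 2).
- by exists `|\det F0|.
- by lra.
have detF : 0 < `|\det F| by apply: lt_trans Fsup; lra.
have uF : F \in unitmx by rewrite unitmxE unitfE -normr_gt0.
exists F; split=> // g gD i.
rewrite -(ler_pM2l detF) -normrM -cramer //.
apply: (@le_trans _ _ (sup E)); last by lra.
apply: ub_le_sup => //; eexists; last reflexivity.
move=> j /=; have [ji|ji] := eqVneq j i.
  rewrite (_ : col j _ = g) //; apply/colP => k.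
  by rewrite !mxE ji eqxx.
rewrite (_ : col j _ = col j F) //; apply/colP => k.
by rewrite !mxE (negbTE ji).
Qed.

End Dual.

(** * The projective chart centring the simplex in the unit ball *)

Section SimplexChart.
Set Implicit Arguments.
Unset Strict Implicit.
Context {R : realType} {d : nat}.
Implicit Types (f : 'rV[R]_(1 + d)).

Local Notation N := ((1 + d)%:R : R).

(* Row vectors f are sent to N * sum f (denominator) and f_j - (sum f) / N
   (numerators); the factor N brings the image of the simplex into the ball. *)
Definition simplex_chart : 'M[R]_(1 + d) :=
  row_mx (const_mx N) (\matrix_(i, j) ((i == rshift 1 j)%:R - N^-1)).

Lemma simplex_chart_den f :
  lsubmx (f *m simplex_chart) ord0 ord0 = N * \sum_i f ord0 i.
Proof.
rewrite mul_mx_row row_mxKl mxE mulr_sumr; apply: eq_bigr => i _.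
by rewrite mxE mulrC.
Qed.

Lemma simplex_chart_num f j : rsubmx (f *m simplex_chart) ord0 j =
  f ord0 (rshift 1 j) - (\sum_i f ord0 i) / N.
Proof.
rewrite mul_mx_row row_mxKr mxE.
under eq_bigr do rewrite mxE mulrBr.
rewrite big_split /= sumrN -mulr_suml; congr (_ - _).
rewrite (bigD1 (rshift 1 j)) //= eqxx mulr1 big1 ?addr0 // => i ij.
by rewrite (negbTE ij) mulr0.
Qed.

Lemma simplex_chart_unit : simplex_chart \in unitmx.
Proof.
rewrite -row_free_unit -kermx_eq0; apply/rowV0P => f /sub_kermxP fT.
have N0 : N != 0 by rewrite pnatr_eq0.
have s0 : \sum_i f ord0 i = 0.
  have /eqP := simplex_chart_den f.
  by rewrite fT !mxE eq_sym mulf_eq0 (negbTE N0) => /eqP.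
have fr j : f ord0 (rshift 1 j) = 0.
  by have := simplex_chart_num f j; rewrite fT !mxE s0 mul0r subr0.
have fl : f ord0 (lshift d ord0) = 0.
  move: s0; rewrite big_split_ord /= big_ord1 [X in _ + X]big1 ?addr0 //.
apply/rowP => i; rewrite [RHS]mxE; have [j ->|j ->] := split_ordP i => //.
by rewrite (_ : j = ord0) //; apply/val_inj; case: j => -[].
Qed.

End SimplexChart.

(** * Lower bound for proper convex domains *)

Section ConvexLowerBound.
Set Implicit Arguments.
Unset Strict Implicit.
Context {R : realType} {d : nat}.
Implicit Types (D : set 'rV[R]_d) (x y z : 'rV[R]_d).
Local Notation N := ((1 + d)%:R : R).

(** For [r > 1] a unit vector, available as [d > 0], would lie in the image, which is inside the
    open unit ball. The bound makes the supremum in [squeezing] a genuine one. *)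
Lemma le1_squeeze_adm D z (r : R) : (0 < d)%N -> squeeze_adm D z r -> r <= 1.
Proof.
move=> d0 [r0 [M [_ _ _ MD Mr]]]; rewrite leNgt; apply/negP => r1.
pose e : 'rV[R]_d := delta_mx ord0 (Ordinal d0).
have se : sqnorm e = 1.
  rewrite /sqnorm (bigD1 (Ordinal d0)) //= mxE !eqxx expr1n big1 ?addr0 //.
  by move=> i i0; rewrite mxE (negbTE i0) andbF expr0n.
have [|x Dx xe] := Mr e; first by rewrite /eball0 /= se expr_gt1 // ltW.
by have := MD _ Dx; rewrite xe /eball0 /= se expr1n ltxx.
Qed.

Lemma le_squeezing D z (r : R) : (0 < d)%N -> squeeze_adm D z r ->
  r <= squeezing D z.
Proof.
move=> d0 ar; rewrite /squeezing; case: pselect => [h|[]]; last by exists r.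
by apply: ub_le_sup => //; exists 1 => s; exact: le1_squeeze_adm.
Qed.

Lemma convex_squeeze_adm D z : convex_set D -> open D -> proper_set D -> D z ->
  squeeze_adm D z (8 * N ^+ 3)^-1.
Proof.
move=> cD oD pD Dz.
have N1 : 1 <= N by rewrite ler1n.
have N0 : 0 < N by lra.
have Nn0 : 1 + d%:R != 0 :> R by rewrite nat1r gt_eqF.
(* Chosen so that the estimate [2 * N ^+ 2 * (N * r)] for the perturbation [e] below equals 1/4. *)
set r := _^-1.
have r0 : 0 < r by rewrite invr_gt0 mulr_gt0 // exprn_gt0.
have [F [FD uF Fmax]] := dual_almost_maximal_basis cD oD pD Dz.
pose f x := homog x *m F.
have fE x i : f x ord0 i = ev (col i F) x.
  by rewrite /ev /f !mxE; apply: eq_bigr => k _; rewrite [col _ _ _ _]mxE.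
have denE x : pden (F *m simplex_chart) x = N * \sum_i f x ord0 i.
  by rewrite /pden /pimg mulmxA simplex_chart_den.
have mapE x j : Defs.pmap (F *m simplex_chart) x ord0 j =
    (N * \sum_i f x ord0 i)^-1 *
    (f x ord0 (rshift 1 j) - (\sum_i f x ord0 i) / N).
  by rewrite /Defs.pmap denE mxE /pimg mulmxA simplex_chart_num.
have fz i : f z ord0 i = 1 by rewrite fE; have [] := FD i.
have fge0 x i : D x -> 0 <= f x ord0 i.
  by move=> Dx; rewrite fE; have [_] := FD i; exact.
(* If all [f x i] vanished, invertibility of [F] would give [homog x = 0], but its first coordinate
   is 1. *)
have sum_gt0 x : D x -> 0 < \sum_i f x ord0 i.
  move=> Dx; rewrite lt_def sumr_ge0 => [|i _]; last exact: fge0.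
  rewrite andbT; apply/eqP => /psumr_eq0P h.
  have f0 : f x = 0.
    by apply/rowP => i; rewrite [RHS]mxE h // => j _; exact: fge0.
  have := congr1 (mulmx^~ (invmx F)) f0; rewrite mulmxK // mul0mx.
  move/rowP => /(_ (lshift d ord0)); rewrite row_mxEl !mxE.
  by apply/eqP; rewrite oner_eq0.
split=> //; exists (F *m simplex_chart); split.
- by rewrite unitmx_mul uF simplex_chart_unit.
- by move=> x Dx; rewrite denE mulf_neq0 // gt_eqF // sum_gt0.
- apply/rowP => j; rewrite mapE fz (eq_bigr (fun=> 1)) => [|i _]; last exact: fz.
  by rewrite sumr_const card_ord divff // subrr mulr0 mxE.
- move=> x Dx; rewrite /eball0 /= expr1n.
  have s0 := sum_gt0 _ Dx.
  (* Each coordinate is [(a / S - N^-1) / N] with [a / S] in [0, 1]; summing [d] squares gives at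
     most [d / N < 1]. *)
  have hj j : Defs.pmap (F *m simplex_chart) x ord0 j ^+ 2 <= N^-1.
    rewrite mapE; set S := \sum_i _ in s0 *; set a := f x ord0 _.
    have a0 : 0 <= a by exact: fge0.
    have aS : a <= S.
      rewrite /S (bigD1 (rshift 1 j)) //= lerDl.
      by apply: sumr_ge0 => i _; exact: fge0.
    have -> : (N * S)^-1 * (a - S / N) = (a / S - N^-1) / N.
      by field; rewrite Nn0 gt_eqF.
    have a1 : 0 <= a / S by rewrite divr_ge0 // ltW.
    have a2 : a / S <= 1 by rewrite ler_pdivrMr // mul1r.
    have V0 : 0 < N^-1 by rewrite invr_gt0.
    have V1 : N^-1 <= 1 by rewrite invf_le1.
    have h1 : (a / S - N^-1) ^+ 2 <= 1 by nra.
    rewrite exprMn; have h2 : N^-1 ^+ 2 <= N^-1 by nra.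
    have h3 := sqr_ge0 (N^-1).
    by nra.
  apply: (@le_lt_trans _ _ (\sum_(i < d) N^-1)).
    by apply: ler_sum => j _; exact: hj.
  rewrite sumr_const card_ord -[_ *+ d]mulr_natl ltr_pdivrMr // mul1r ltr_nat.
  by rewrite add1n.
move=> y yr.
(* Inverting the chart: [1 + e] has coordinate sum [N], so its image has coordinates
   [e_j / N ^+ 2 = y_j]. The first entry makes [e] sum to zero. *)
pose e : 'rV[R]_(1 + d) :=
  row_mx (const_mx (- (N ^+ 2 * \sum_i y ord0 i))) (N ^+ 2 *: y).
have sume : \sum_i e ord0 i = 0.
  rewrite big_split_ord /= big_ord1 row_mxEl mxE mulr_sumr.
  rewrite [X in _ + X](eq_bigr (fun i => N ^+ 2 * y ord0 i)) ?addNr // => i _.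
  by rewrite row_mxEr mxE.
have yi i : `|y ord0 i| <= r.
  rewrite -ler_sqr ?nnegrE ?normr_ge0 // ?(ltW r0) //.
  rewrite (real_normK (num_real _)).
  by apply: le_trans (ltW yr); exact: coord_le_sqnorm.
have sumy : \sum_i `|y ord0 i| <= N * r.
  apply: (@le_trans _ _ (\sum_(i < d) r)); first by apply: ler_sum => i _.
  by rewrite sumr_const card_ord -[_ *+ d]mulr_natl ler_pM2r // ler_nat leq_addl.
have norme : \sum_i `|e ord0 i| <= 4^-1.
  have -> : 4^-1 = 2 * N ^+ 2 * (N * r) :> R by rewrite /r; field.
  apply: (@le_trans _ _ (2 * N ^+ 2 * \sum_i `|y ord0 i|)); last first.
    by rewrite ler_pM2l // mulr_gt0 // exprn_gt0.
  rewrite big_split_ord /= big_ord1 row_mxEl mxE normrN normrM.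
  have N20 : 0 < N ^+ 2 by rewrite exprn_gt0.
  rewrite (gtr0_norm N20).
  rewrite [X in _ + X](eq_bigr (fun i => N ^+ 2 * `|y ord0 i|)); last first.
    by move=> i _; rewrite row_mxEr mxE normrM gtr0_norm.
  rewrite -mulr_sumr.
  have := ler_norm_sum (index_enum 'I_d) (fun i => y ord0 i) predT => /= h.
  by nra.
have [X XF] : exists X : 'rV[R]_(1 + d), X *m F = const_mx 1 + e.
  by exists ((const_mx 1 + e) *m invmx F); rewrite mulmxKV.
(* The coefficients [l] of [g] sum to 1, by evaluation at [z], and are bounded by 2, so the value at
   [X] is at least [1 - 2 / 4]. *)
have Xg g : dual_body D z g -> 2^-1 <= (X *m g) ord0 ord0.
  move=> gD; have gE : g = F *m (invmx F *m g) by rewrite mulKVmx.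
  have [gz _] := gD.
  set l := invmx F *m g in gE.
  have suml : \sum_i l i ord0 = 1.
    rewrite -gz gE /ev mulmxA mxE; apply: eq_bigr => i _.
    by rewrite -/(f z) fz mul1r.
  rewrite gE mulmxA XF mulmxDl mxE.
  have -> : ((const_mx 1 : 'rV_(1 + d)) *m l) ord0 ord0 = 1.
    by rewrite mxE -[RHS]suml; apply: eq_bigr => i _; rewrite mxE mul1r.
  suff : `|(e *m l) ord0 ord0| <= 2^-1 by rewrite ler_norml => /andP[]; lra.
  rewrite mxE; apply: le_trans (ler_norm_sum _ _ _) _.
  apply: (@le_trans _ _ (\sum_i `|e ord0 i| * 2)); last first.
    by rewrite -mulr_suml; lra.
  by apply: ler_sum => i _; rewrite normrM ler_wpM2l ?normr_ge0 // Fmax.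
(* Testing [X] against the constant 1 shows that it is not at infinity, so it represents a point
   [x]. *)
pose X0 := X ord0 (lshift d ord0).
have X0_gt0 : 0 < X0.
  have := Xg _ (dual1 D z); rewrite mxE (bigD1 (lshift d ord0)) //= mxE !eqxx mulr1.
  rewrite big1 ?addr0 => [|i i0]; first by rewrite /X0; lra.
  by rewrite mxE (negbTE i0) mulr0.
pose x := X0^-1 *: rsubmx X.
have XE : X = X0 *: homog x.
  rewrite /homog scale_row_mx /x scalerA divff ?gt_eqF // scale1r.
  rewrite -[LHS]hsubmxK; congr row_mx; apply/rowP => i; rewrite !mxE mulr1.
  by congr (X _ (lshift _ _)); apply/val_inj; case: i => -[].
have evX g : (X *m g) ord0 ord0 = X0 * ev g x.
  by rewrite XE -scalemxAl mxE.
have Dx : D x.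
  apply: contrapT => nDx.
  (* At this level the separating functional is at most 1/4 on [X], against the bound 1/2. *)
  have t0 : 0 < (4 * X0)^-1 by rewrite invr_gt0 mulr_gt0.
  have [g gD gx] := dual_separation cD oD Dz nDx t0.
  have := Xg _ gD; rewrite evX leNgt => /negP; apply.
  apply: (@le_lt_trans _ _ (X0 * (4 * X0)^-1)); first by rewrite ler_pM2l.
  have -> : X0 * (4 * X0)^-1 = 4^-1 by field; rewrite gt_eqF.
  by lra.
exists x => //; apply/rowP => j; rewrite mapE.
have fx i : f x ord0 i = X0^-1 * (1 + e ord0 i).
  have -> : f x = X0^-1 *: (X *m F).
    by rewrite XE -scalemxAl scalerA mulVf ?gt_eqF // scale1r.
  by rewrite XF !mxE.
have -> : \sum_i f x ord0 i = X0^-1 * N.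
  rewrite (eq_bigr _ (fun i _ => fx i)) -mulr_sumr big_split /= sume addr0.
  by rewrite sumr_const card_ord.
rewrite fx row_mxEr mxE; field.
by rewrite Nn0 gt_eqF.
Qed.

End ConvexLowerBound.

(** * Convexity and properness from uniform squeezing *)

Section UniformSqueezing.
Set Implicit Arguments.
Unset Strict Implicit.
Context {R : realType} {d : nat}.
Implicit Types (D : set 'rV[R]_d) (x y z p q : 'rV[R]_d) (M : 'M[R]_(1 + d)).

Lemma squeezing_ge0 D z : (0 < d)%N -> 0 <= squeezing D z.
Proof.
move=> d0; have [[r ar]|h] := pselect (squeeze_adm D z !=set0).
  by apply: le_trans (le_squeezing d0 ar); case: ar => /ltW.
by rewrite /squeezing; case: pselect.
Qed.

Lemma squeezing_gt_adm D z (c : R) : 0 <= c -> c < squeezing D z ->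
  exists2 r, squeeze_adm D z r & c < r.
Proof.
move=> c0; rewrite /squeezing; case: pselect => [h|_]; first exact: sup_gt.
by move=> /(le_lt_trans c0); rewrite ltxx.
Qed.

Lemma pimg_conv M p q (t : R) :
  pimg M (t *: q + (1 - t) *: p) = t *: pimg M q + (1 - t) *: pimg M p.
Proof. by rewrite /pimg homog_conv mulmxDl -!scalemxAl. Qed.

Lemma pden_conv M p q (t : R) :
  pden M (t *: q + (1 - t) *: p) = t * pden M q + (1 - t) * pden M p.
Proof. by rewrite /pden pimg_conv !mxE. Qed.

Lemma pdenE M x : pden M x = ev (col (lshift d ord0) M) x.
Proof.
by rewrite /pden /ev !mxE; apply: eq_bigr => i _; rewrite [col _ _ _ _]mxE.
Qed.

Lemma continuous_pden M : continuous (pden M).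
Proof.
have -> : pden M = fun x => M (lshift d ord0) (lshift d ord0) +
    \sum_i x ord0 i * M (rshift 1 i) (lshift d ord0).
  apply/funext => x; rewrite pdenE evE mxE; congr (_ + _).
  by apply: eq_bigr => i _; rewrite mxE.
move=> x; apply: continuousD; first exact: cst_continuous.
apply: continuous_big => [|i _ y]; first exact: add_continuous.
apply: continuousM; first exact: coord_continuous.
exact: cst_continuous.
Qed.

(** The denominator maps the connected set [D] onto an interval that misses 0. *)
Lemma pden_same_sign D M p q : connected D -> (forall x, D x -> pden M x != 0) ->
  D p -> D q -> 0 < pden M p * pden M q.
Proof.
move=> cD MD.
have /connected_intervalP intD : connected [set pden M x | x in D].
  apply: connected_continuous_connected => //.
  by apply: continuous_subspaceT; exact: continuous_pden.
have aux a b : D a -> D b -> pden M a < 0 -> 0 < pden M b -> False.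
  move=> Da Db a0 b0.
  have [|||x Dx x0] := intD (pden M a) (pden M b) _ _ 0.
  - by exists a.
  - by exists b.
  - by rewrite !ltW.
  by move/eqP : (MD x Dx).
move=> Dp Dq.
have [q0|q0|/eqP] := ltgtP (pden M q) 0; last by rewrite (negbTE (MD _ Dq)).
  all: have [p0|p0|/eqP] := ltgtP (pden M p) 0; last by rewrite (negbTE (MD _ Dp)).
- by rewrite nmulr_rgt0.
- by have := aux _ _ Dq Dp q0 p0.
- by have := aux _ _ Dp Dq p0 q0.
- by rewrite mulr_gt0.
Qed.

Lemma pimgE M x : pden M x != 0 ->
  pimg M x = pden M x *: row_mx (const_mx 1) (Defs.pmap M x).
Proof.
move=> x0; rewrite /Defs.pmap scale_row_mx scalerA divff // scale1r.
rewrite -[LHS]hsubmxK; congr row_mx; apply/rowP => i.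
by rewrite [RHS]mxE [const_mx _ _ _]mxE mulr1 /pden ord1.
Qed.

(** Equal images make the homogeneous vectors proportional, and their first coordinate 1 fixes the
    factor. *)
Lemma pmap_inj M x y : M \in unitmx -> pden M x != 0 -> pden M y != 0 ->
  Defs.pmap M x = Defs.pmap M y -> x = y.
Proof.
move=> uM x0 y0 xy.
pose k := pden M x / pden M y.
have : homog x = k *: homog y.
  apply: (can_inj (mulmxK uM)).
  rewrite -scalemxAl -[LHS]/(pimg M x) -/(pimg M y) !pimgE // xy scalerA.
  by rewrite divfK.
rewrite /homog scale_row_mx => /eq_row_mx[/rowP/(_ ord0)].
by rewrite !mxE mulr1 => <-; rewrite scale1r.
Qed.

(** Along a line in [D] the denominator is affine without zeros, hence constant; the numerators are
    then bounded and affine, hence constant, so [M] kills the direction. *)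
Lemma squeeze_adm_proper D z (r : R) : squeeze_adm D z r -> proper_set D.
Proof.
move=> [_ [M [uM MD _ Mb _]]] [p [v [v0 line]]].
pose V := row_mx 0 v *m M.
have imE t : pimg M (p + t *: v) = pimg M p + t *: V.
  by rewrite /pimg homogDZ mulmxDl -scalemxAl.
pose b := lsubmx V ord0 ord0.
have denE t : pden M (p + t *: v) = pden M p + t * b.
  by rewrite /pden imE linearD linearZ /= mxE; congr (_ + _); rewrite mxE.
have b0 : b = 0.
  apply/eqP; apply: contraT => b0; have := MD _ (line (- pden M p / b)).
  by rewrite denE divfK // subrr eqxx.
have p0 : pden M p != 0 by have := MD _ (line 0); rewrite scale0r addr0.
have V0 j : rsubmx V ord0 j = 0.
  apply/eqP; apply: contraT => Vj.
  (* At this parameter the [j]-th image coordinate is exactly 1, outside the open ball. *)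
  pose t := (pden M p - rsubmx (pimg M p) ord0 j) / rsubmx V ord0 j.
  have := Mb _ (line t); rewrite /eball0 /= expr1n.
  apply: contraTT => _; rewrite -leNgt.
  apply: le_trans (coord_le_sqnorm _ j).
  rewrite /Defs.pmap denE b0 mulr0 addr0 imE linearD linearZ /=.
  rewrite mxE [X in _ * X](_ : _ = pden M p); first by rewrite mulVf // expr1n.
  by rewrite mxE [X in _ + X]mxE divfK // subrKC.
have : row_mx 0 v = 0 :> 'rV[R]_(1 + d).
  apply: (can_inj (mulmxK uM)); rewrite mul0mx -/V -[V]hsubmxK.
  rewrite -[RHS](@row_mx0 _ 1 1 d); congr row_mx; apply/rowP => j.
    by rewrite ord1 -/b b0 mxE.
  by rewrite V0 mxE.
by rewrite -[RHS](@row_mx0 _ 1 1 d) => /eq_row_mx[_ /eqP]; apply/negP.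
Qed.

Lemma squeeze_adm_segment D p q (r t w : R) : connected D -> D p -> D q ->
  0 < t -> t < w -> w < 1 ->
  let x s := s *: q + (1 - s) *: p in
  D (x t) -> ~ D (x w) -> squeeze_adm D (x t) r ->
  r * ((1 - w) * t + w * (1 - t)) < w - t.
Proof.
move=> cD Dp Dq t0 tw w1 x Dt Dw [r0 [M [uM MD Mt Mb Mr]]].
have ab := pden_same_sign cD MD Dp Dq.
set a := pden M p in ab; set b := pden M q in ab.
have a0 : a != 0 by exact: MD.
have b0 : b != 0 by exact: MD.
pose np := rsubmx (pimg M p); pose nq := rsubmx (pimg M q).
have numE s : rsubmx (pimg M (x s)) = s *: nq + (1 - s) *: np.
  by rewrite pimg_conv linearD !linearZ.
have denE s : pden M (x s) = s * b + (1 - s) * a by exact: pden_conv.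
have nt : t *: nq + (1 - t) *: np = 0.
  move: Mt; rewrite /Defs.pmap numE => /eqP.
  by rewrite scaler_eq0 invr_eq0 (negbTE (MD _ Dt)) => /eqP.
pose m := nq - np.
have mE s : s *: nq + (1 - s) *: np = (s - t) *: m.
  rewrite -[LHS]subr0 -nt; apply/rowP => i.
  by rewrite /m !mxE; ring.
have npE : np = (- t) *: m 
  by rewrite -[- t]add0r -mE scale0r add0r subr0 scale1r.
(* The numerator along the segment is affine and vanishes at [t], so it is [(s - t) *: m]; the
   endpoints are the cases [s = 0] and [s = 1]. *)
have nqE : nq = (1 - t) *: m by rewrite -mE scale1r subrr scale0r addr0.
pose n := Num.sqrt (sqnorm m).
have n0 : 0 <= n by exact: sqrtr_ge0.
have nn : sqnorm m = n ^+ 2 by rewrite sqr_sqrtr // sqnorm_ge0.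
have unsq (u v : R) : 0 <= u -> v != 0 -> v^-1 ^+ 2 * (u ^+ 2 * n ^+ 2) < 1 ->
    u * n < `|v|.
  move=> u0 v0; rewrite -exprMn exprVn mulrC ltr_pdivrMr; last first.
    by rewrite lt_def sqr_ge0 sqrf_eq0 v0.
  by rewrite mul1r -(real_normK (num_real v)) ltr_sqr ?nnegrE ?normr_ge0 // mulr_ge0.
have ha : t * n < `|a|.
  apply: unsq => //; first exact: ltW.
  have := Mb _ Dp; rewrite /eball0 /= expr1n /Defs.pmap -/np npE !sqnormZ nn.
  by rewrite sqrrN.
have hb : (1 - t) * n < `|b|.
  apply: unsq => //; first lra.
  by have := Mb _ Dq; rewrite /eball0 /= expr1n /Defs.pmap -/nq nqE !sqnormZ nn.
(* Equal signs at [p] and [q] let absolute values add, so the exit point is not a pole even though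
   it lies outside [D]. *)
have denw : `|pden M (x w)| = w * `|b| + (1 - w) * `|a|.
  rewrite denE; have [a1|a1] := ltP 0 a.
    have b1 : 0 < b by rewrite -(pmulr_rgt0 _ a1).
    by rewrite !gtr0_norm // addr_gt0 // mulr_gt0 //; lra.
  have a2 : a < 0 by rewrite lt_neqAle a0.
  have b2 : b < 0 by rewrite -(nmulr_rgt0 _ a2).
  rewrite !ltr0_norm //; first ring.
  by nra.
have denw0 : 0 < `|pden M (x w)|.
  by rewrite denw addr_gt0 // mulr_gt0 ?normr_gt0 //; lra.
(* Otherwise the image of [x w] lies in the [r]-ball, hence is also the image of a point of [D], and
   injectivity puts [x w] in [D]. *)
have hw : r * `|pden M (x w)| <= (w - t) * n.
  rewrite leNgt; apply/negP => h; have [|y Dy yw] := Mr (Defs.pmap M (x w)).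
    rewrite /eball0 /= /Defs.pmap numE mE !sqnormZ nn exprVn mulrC -exprMn.
    rewrite -(real_normK (num_real (pden _ _))) ltr_pdivrMr ?exprn_gt0 //.
    by rewrite -exprMn ltr_sqr // nnegrE mulr_ge0 ?(ltW r0) ?(ltW denw0) //; lra.
  apply: Dw; rewrite -(pmap_inj uM _ _ yw) //; first exact: MD.
  by rewrite -normr_gt0.
have main : r * ((1 - w) * t + w * (1 - t)) * n < (w - t) * n.
  apply: lt_le_trans hw; rewrite denw -mulrA ltr_pM2l //.
  by nra.
have np0 : 0 < n.
  by rewrite lt_def n0 andbT; apply: contraTneq main => ->; rewrite !mulr0 ltxx.
by rewrite ltr_pM2r in main.
Qed.

Lemma uniform_squeezing_convex D (c : R) : domain D -> 0 < c -> c <= 1 ->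
  (forall z, D z -> exists2 r, squeeze_adm D z r & c < r) -> convex_set D.
Proof.
move=> [_ oD cD] c0 c1 cadm; apply/convex_setP => q p t Dq Dp t0 t1.
pose x s := s *: q + (1 - s) *: p.
apply: contrapT => nDt.
have oU : open (x @^-1` D).
  apply: open_comp => // s _; apply: cvgD; first exact: scalel_continuous.
  apply: cvgZ; last exact: cvg_cst.
  by apply: cvgB; [exact: cvg_cst|exact: cvg_id].
pose W := [set s | 0 <= s /\ ~ D (x s)].
have Wt : W t by [].
have Wlb : has_lbound W by exists 0 => s [].
pose w := inf W.
have w0 : 0 <= w by apply: lb_le_inf => [|s []//]; exists t.
have wt : w <= t by exact: ge_inf.
have below s : 0 <= s -> s < w -> D (x s).
  move=> s0 sw; apply: contrapT => ns.
  by have := ge_inf Wlb (conj s0 ns); rewrite leNgt sw.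
(* The first exit point itself is outside [D], as [D] is open. *)
have nDw : ~ D (x w).
  move=> Dw; have /nbhs_ballP[e /= e0 eU] : nbhs w (x @^-1` D).
    by apply: open_nbhs_nbhs.
  have [||s [s0 ns] sw] := @inf_adherent _ W e => //.
    by split=> //; exists t.
  have ws : w <= s by exact: ge_inf.
  apply/ns/eU; rewrite /ball /= ltr_norml.
  by move: sw; rewrite -/w; lra.
have w_gt0 : 0 < w.
  rewrite lt_def w0 andbT; apply: contra_notN nDw => /eqP ->.
  by rewrite /x scale0r add0r subr0 scale1r.
have w_lt1 : w < 1.
  rewrite lt_neqAle (le_trans wt t1) andbT; apply: contra_notN nDw => /eqP ->.
  by rewrite /x scale1r subrr scale0r addr0.
have ww : 0 < w * (1 - w) by rewrite mulr_gt0 // subr_gt0.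
(* Now [w - u] is [c * (w * (1 - w)) / 2], while [c <= 1] keeps [u >= w / 2]; so [r > c] contradicts
   the segment inequality without a limit. *)
pose u := w - c * (w * (1 - w)) / 2.
have uw2 : w / 2 <= u by rewrite /u; nra.
have uw : u < w.
  by rewrite /u ltrBlDr ltrDl divr_gt0 // mulr_gt0.
have u0 : 0 < u by lra.
have Du : D (x u) by apply: below => //; exact: ltW.
have [r ar cr] := cadm _ Du.
have := squeeze_adm_segment cD Dp Dq u0 uw w_lt1 Du nDw ar.
have h1 : w * (1 - w) / 2 <= (1 - w) * u + w * (1 - u) by nra.
have -> : w - u = c * (w * (1 - w)) / 2 by rewrite /u; lra.
by rewrite ltNge => /negP; apply; nra.
Qed.

End UniformSqueezing.

Theorem theorem1 (R : realType) :
  (forall d : nat, (1 <= d)%N ->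
     exists rd : R, 0 < rd /\
       forall D : set 'rV[R]_d, domain D -> convex_set D -> proper_set D ->
         forall z, D z -> rd <= squeezing D z) /\
  (forall d : nat, (1 <= d)%N ->
     forall D : set 'rV[R]_d, domain D ->
       0 < inf [set squeezing D z | z in D] ->
       convex_set D /\ proper_set D).
Proof.
split=> d d0.
  exists (8 * (1 + d)%:R ^+ 3)^-1; split.
    by rewrite invr_gt0 mulr_gt0 // exprn_gt0 // ltr0n.
  move=> D [_ oD _] cD pD z Dz.
  by apply: le_squeezing => //; exact: convex_squeeze_adm.
move=> D domD; set m := inf _ => m0.
(* Half the infimum leaves a strict gap below every value of [squeezing], so an admissible radius
   above [m / 2] exists at each point. *)
have cadm z : D z -> exists2 r, squeeze_adm D z r & m / 2 < r.
  move=> Dz; apply: squeezing_gt_adm; first by rewrite divr_ge0 // ltW.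
  apply: (@lt_le_trans _ _ m); first lra.
  apply: ge_inf; last by exists z.
  by exists 0 => _ [y _ <-]; exact: squeezing_ge0.
have [[z Dz] _ _] := domD.
have [r ar mr] := cadm z Dz.
split; last exact: squeeze_adm_proper ar.
apply: (@uniform_squeezing_convex _ _ D (m / 2)) => //; first by rewrite divr_gt0.
exact: le_trans (ltW mr) (le1_squeeze_adm d0 ar).
Qed.
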